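(* Let $G$ be a triangle-free graph with $\operatorname{diam}(G)=2$ and $|E(G)|\ge 4$. Then $G$ is edge-reconstructible; that is, every graph $H$ with $\mathcal{ED}(H)=\mathcal{ED}(G)$ is isomorphic to $G$.
   Context: All graphs are finite and simple. $\operatorname{diam}(G)=\max_{u,v\in V(G)} d_G(u,v)$, where $d_G(u,v)$ is the length of a shortest path from $u$ to $v$ in $G$ (so a graph of finite diameter is connected). An edge-card of $G$ is a graph $G-e$ with $e\in E(G)$ (the edge is deleted and all vertices are kept), and the edge-deck of $G$ is the multiset $\mathcal{ED}(G)=\{G-e: e\in E(G)\}$, with edge-cards considered up to isomorphism. Thus $\mathcal{ED}(H)=\mathcal{ED}(G)$ means there is a bijection $\psi:E(G)\to E(H)$ with $G-e\cong H-\psi(e)$ for all $e\in E(G)$. *)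

(* Defs.v *)
From mathcomp Require Import all_boot.

Set Implicit Arguments.
Unset Strict Implicit.
Unset Printing Implicit Defensive.

Record sgraph := SGraph {
  vertex :> finType;
  adj : rel vertex;
  adj_sym : symmetric adj;
  adj_irrefl : irreflexive adj
}.

Definition edges (G : sgraph) : {set {set G}} :=
  [set [set x; y] | x in [set: G], y in [set: G] & adj x y].

Definition iso (G H : sgraph) : Prop :=
  exists2 f : G -> H, bijective f & {mono f : x y / adj x y}.

Definition triangle_free (G : sgraph) : Prop :=
  forall x y z : G, ~~ [&& adj x y, adj y z & adj x z].

Definition has_path (G : sgraph) (u v : G) (n : nat) : bool :=
  [exists p : n.-tuple G,
     [&& path (@adj G) u p, uniq (u :: p) & last u p == v]].

(* A path has fewer than #|G| edges, so the search is exhaustive; it returns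
   the junk value #|G| when there is no path from u to v. *)
Definition dist (G : sgraph) (u v : G) : nat :=
  find (has_path u v) (iota 0 #|G|).

Definition connected (G : sgraph) : bool :=
  [forall u : G, forall v : G, connect (@adj G) u v].

(* [None] stands for the infinite diameter of a disconnected graph. *)
Definition diam (G : sgraph) : option nat :=
  if connected G then Some (\max_(u : G) \max_(v : G) dist u v) else None.

Section DeleteEdge.
Variables (G : sgraph) (A : {set G}).

Definition del_adj : rel G := fun x y => adj x y && ([set x; y] != A).

Lemma del_adj_sym : symmetric del_adj.
Proof. by move=> x y; rewrite /del_adj adj_sym setUC. Qed.

Lemma del_adj_irrefl : irreflexive del_adj.
Proof. by move=> x; rewrite /del_adj adj_irrefl. Qed.

Definition del_edge : sgraph := SGraph del_adj_sym del_adj_irrefl.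
End DeleteEdge.

(* The bijection E(G) -> E(H) is the restriction to [edges G] of a function
   on all vertex sets; its values off [edges G] are irrelevant. *)
Definition same_edge_deck (G H : sgraph) : Prop :=
  exists psi : {set G} -> {set H},
    [/\ {in edges G &, injective psi},
        psi @: edges G = edges H
      & forall A : {set G}, A \in edges G ->
          iso (del_edge A) (del_edge (psi A))].

Definition edge_reconstructible (G : sgraph) : Prop :=
  forall H : sgraph, same_edge_deck G H -> iso H G.

(* Main.v *)
Require Import Defs.
From mathcomp Require Import all_boot.

Set Implicit Arguments.
Unset Strict Implicit.
Unset Printing Implicit Defensive.

(** Let H have the edge-deck of G, and suppose that H is not isomorphic to G.
    As |E| >= 4, any three edges of H lie together on a card, so H inherits
    triangle-freeness from G.

    Every edge ab of H belongs to a card, hence G is H - ab + f for some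
    f <> ab. In G the vertices a and b are nonadjacent, so they have a common
    neighbour; they have none in H, so f creates it. Up to exchanging a and b,
    this means f = ac with c adjacent to b in H: the edge ab is switched to ac
    along the path a - b - c ([deck_good_switch]). As G has no triangle, b is
    the only common neighbour of a and c in H: the path a - b - c is the unique
    path of length 2 between its ends.

    That H - ab + ac has diameter 2 makes a - b - c the only path through the
    edge ab that is unique in this sense ([good_switch_unique],
    [good_switch_detour]). Moreover G and H have equally many paths of length 2
    ([deck_cherries], an instance of Kelly's counting lemma), which forces
    deg b = deg c + 1 ([good_switch_degree]). The edge bc has its own switch,
    which by uniqueness goes along the same path in the other direction, so
    deg b = deg a + 1 as well ([good_switch_far_degree]).

    Therefore the degrees of adjacent vertices of H differ by exactly 1, and
    the parity of the degree is a proper 2-colouring of H. In H - ab + ac the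
    edge ac is the only one inside a colour class, so two vertices of different
    colours that have a common neighbour there are joined to it through ac.
    This makes H nearly complete bipartite, and comparing the degree of b with
    that of any other vertex y of its colour gives deg b = deg y + 1, against
    the parity. So b is alone in its class, deg a = 1, deg b = 2, and H has
    only two edges ([not_all_switchable]). *)

(** * Edges, triangles and common neighbours *)

Lemma eq_set2 (T : finType) (x y a b : T) :
  ([set x; y] == [set a; b]) =
  ((x == a) && (y == b)) || ((x == b) && (y == a)).
Proof.
apply/eqP/idP => [E|]; last first.
  by case/orP => /andP[/eqP-> /eqP->] //; rewrite setUC.
have xab : x \in [set a; b] by rewrite -E set21.
have yab : y \in [set a; b] by rewrite -E set22.
have axy : a \in [set x; y] by rewrite E set21.
have bxy : b \in [set x; y] by rewrite E set22.
case/set2P: xab axy bxy => ->; case/set2P: yab => ->;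
  by rewrite !inE ?(eq_sym b a) ?eqxx; case: (a == b).
Qed.

Lemma edgesP (X : sgraph) (A : {set X}) :
  reflect (exists x y, adj x y /\ A = [set x; y]) (A \in edges X).
Proof.
apply: (iffP imset2P) => [[x y _]|[x [y [xy ->]]]].
  by rewrite !inE => /andP[_ xy] ->; exists x, y.
by exists x y; rewrite // !inE.
Qed.

Lemma edges_set2 (X : sgraph) (x y : X) : ([set x; y] \in edges X) = adj x y.
Proof.
apply/edgesP/idP => [[a [b [ab /eqP]]]|xy]; last by exists x, y.
by rewrite eq_set2 => /orP[] /andP[/eqP-> /eqP->] //; rewrite adj_sym.
Qed.

Lemma adj_neq (X : sgraph) (x y : X) : adj x y -> x != y.
Proof. by case: eqP => // ->; rewrite adj_irrefl. Qed.

(** The graphs obtained from H by exchanging edges live on the vertices of H,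
    and only their adjacency relation matters; the notions below are therefore
    stated for bare relations. *)
Definition rel_triangle_free (T : finType) (e : rel T) :=
  forall x y z, e x y -> e y z -> e x z -> False.

Definition dist_le2 (T : finType) (e : rel T) :=
  forall x y, x != y -> ~~ e x y -> exists z, e x z /\ e z y.

Definition degree (T : finType) (e : rel T) (x : T) := #|[pred y | e x y]|.

(** * Counting paths of length 2 *)

(** The triple [(y, x, z)] stands for the path x - y - z: the centre comes
    first. *)
Definition is_cherry (T : finType) (e : rel T) (t : T * T * T) :=
  [&& e t.1.1 t.1.2, e t.1.1 t.2 & t.1.2 != t.2].

Definition cherries (T : finType) (e : rel T) := \sum_t is_cherry e t.

Lemma cherries_degree (T : finType) (e : rel T) :
  cherries e = \sum_y degree e y * (degree e y).-1.
Proof.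
rewrite /cherries -(pair_bigA _ (fun p z => nat_of_bool (is_cherry e (p, z)))) /=.
rewrite -(pair_bigA _ (fun y x => \sum_z nat_of_bool (is_cherry e (y, x, z)))) /=.
apply: eq_bigr => y _.
rewrite {1}/degree -sum1_card big_distrl /= [RHS]big_mkcond /=.
apply: eq_bigr => x _; rewrite inE /is_cherry /=.
case: ifP => yx; last by rewrite big1.
rewrite mul1n /degree (cardD1 x) inE yx /= -sum1_card [RHS]big_mkcond /=.
by apply: eq_bigr => z _; rewrite !inE eq_sym andbC; case: (_ && _).
Qed.

Lemma cherries_reindex (S T : finType) (e : rel S) (e' : rel T) (f : S -> T) :
  bijective f -> {mono f : x y / e x y >-> e' x y} -> cherries e' = cherries e.
Proof.
move=> [g fK gK] fe; rewrite /cherries.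
rewrite (reindex (fun t : S * S * S => (f t.1.1, f t.1.2, f t.2))) /=; last first.
  exists (fun t => (g t.1.1, g t.1.2, g t.2)) => [[[x y] z]|[[x y] z]] _ /=;
  by rewrite ?fK ?gK.
by apply: eq_bigr => -[[x y] z] _; rewrite /is_cherry /= !fe (can_eq fK).
Qed.

(** Each path of length 2 survives on all cards but the two that delete one of
    its edges. *)
Lemma sum_cherries_cards (X : sgraph) :
  \sum_(A in edges X) cherries (@del_adj X A) =
  (#|edges X| - 2) * cherries (@adj X).
Proof.
rewrite /cherries exchange_big big_distrr /=; apply: eq_bigr => -[[y x] z] _.
rewrite /is_cherry /del_adj /=.
have [/and3P[yx yz xz]|nt] := boolP [&& adj y x, adj y z & x != z]; last first.
  rewrite muln0 big1 // => A _; case: and3P => // -[/andP[yx _] /andP[yz _] xz].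
  by rewrite yx yz xz in nt.
rewrite yx yz xz muln1 /=.
have d : [set y; x] != [set y; z].
  by rewrite eq_set2 eqxx (negbTE xz) (negbTE (adj_neq yz)).
have sub : [set [set y; x]; [set y; z]] \subset edges X.
  by apply/subsetP => A /set2P[->|->]; rewrite edges_set2.
have <- : #|[set [set y; x]; [set y; z]]| = 2 by rewrite cards2 d.
rewrite -(setIidPr sub) -cardsD -sum1_card big_mkcond [RHS]big_mkcond /=.
apply: eq_bigr => A _; rewrite !inE andbT negb_or andbC.
rewrite (eq_sym [set y; x]) (eq_sym [set y; z]); case: (A \in _) => /=; last by rewrite andbF.
by rewrite andbT andbC; case: (_ && _).
Qed.

Lemma deck_cherries (G H : sgraph) :
  2 < #|edges G| -> same_edge_deck G H ->
  cherries (@adj G) = cherries (@adj H).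
Proof.
move=> m2 [psi [psi_inj psiE cards]].
have cE : #|edges H| = #|edges G| by rewrite -psiE card_in_imset.
have : \sum_(B in edges H) cherries (@del_adj H B)
     = \sum_(A in edges G) cherries (@del_adj G A).
  rewrite -psiE big_imset //=; apply: eq_bigr => A /cards[f fb fm].
  exact: (cherries_reindex fb fm).
rewrite !sum_cherries_cards cE => /eqP.
by rewrite eqn_pmul2l ?subn_gt0 // => /eqP.
Qed.

(** * Consequences of the common deck and of diameter 2 *)

(** A triangle uses three edges only, so it survives on the card that deletes a
    fourth one. *)
Lemma deck_triangle_free (G H : sgraph) :
  4 <= #|edges G| -> triangle_free G -> same_edge_deck G H ->
  rel_triangle_free (@adj H).
Proof.
move=> m4 tG [psi [psi_inj psiE cards]] x y z xy yz xz.
have cE : #|edges H| = #|edges G| by rewrite -psiE card_in_imset.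
pose T := [set [set x; y]; [set y; z]; [set x; z]].
have : ~~ (edges H \subset T).
  have T3 : #|T| <= 3.
    rewrite /T setUC cardsU1 cards2.
    by apply: leq_add (leq_b1 _) _; rewrite ltnS leq_b1.
  by apply: contraL m4 => /subset_leq_card; rewrite cE -ltnNge ltnS => /leq_trans; apply.
case/subsetPn => B BH; rewrite !inE !negb_or => /andP[/andP[Bxy Byz] Bxz].
have := BH; rewrite -psiE => /imsetP[A AG EB].
have [f [g fK gK] fm] := cards _ AG.
have gm u v : adj u v -> B != [set u; v] -> @adj G (g u) (g v).
  move=> uv nB; have := fm (g u) (g v); rewrite !gK /= /del_adj -EB uv eq_sym nB.
  by case/esym/andP.
by have /negP[] := tG (g x) (g y) (g z); rewrite !gm.
Qed.

(** The distance is found by a bounded search with a junk value #|G|. Having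
    four edges guarantees #|G| > 2, so that a distance at most 2 is a genuine
    one. *)
Lemma diam2_dist_le2 (G : sgraph) :
  4 <= #|edges G| -> diam G = Some 2 -> dist_le2 (@adj G).
Proof.
rewrite /diam; case: ifP => // _ m4 [dE] x y xy nxy.
have n3 : 2 < #|G|.
  have : #|edges G| < 2 ^ #|G|.
    rewrite -cardsT -card_powerset; apply: proper_card; rewrite properE.
    apply/andP; split; first by apply/subsetP => A _; rewrite inE subsetT.
    apply/subsetPn; exists set0; first by rewrite inE sub0set.
    by apply/edgesP => -[a [b [_ /setP/(_ a)]]]; rewrite !inE eqxx.
  by move=> /(leq_ltn_trans m4); case: #|G| => [|[|[|n]]].
have dxy : dist x y <= 2.
  rewrite -dE; apply: leq_trans (leq_bigmax x).
  exact: (leq_bigmax (F := fun v => dist x v) y).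
have hs : has (has_path x y) (iota 0 #|G|).
  by rewrite has_find size_iota (leq_ltn_trans dxy).
have := nth_find 0 hs; rewrite -/(dist x y) nth_iota ?add0n; last first.
  exact: leq_ltn_trans dxy _.
case/existsP => p /and3P[pp _ /eqP lp].
move: (size_tuple p) dxy; case: (dist x y) p pp lp => [|[|[|k]]] p;
  case: p => -[|u [|v [|w s]]] //= _.
- by move=> _ E; rewrite E eqxx in xy.
- by rewrite andbT => xu E; rewrite -E xu in nxy.
- by rewrite andbT => /andP[xu uv] E; exists u; rewrite -E.
Qed.

Definition replace_edge (X : sgraph) (A C : {set X}) : rel X :=
  fun x y => del_adj A x y || ([set x; y] == C).

(** A common card presents the first graph on the vertices of the second: the
    edge [[set p; q]] is where the deleted edge [A] goes. *)
Lemma card_replace_edge (G H : sgraph) (A : {set G}) (B : {set H}) :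
  A \in edges G -> iso (del_edge A) (del_edge B) ->
  exists (g : H -> G) (p q : H),
    [/\ bijective g, {mono g : x y / replace_edge B [set p; q] x y >-> adj x y}
      & p != q].
Proof.
case/edgesP => u [v [uv EA]] [f [g fK gK] fm].
exists g, (f u), (f v); split; first by exists f.
  move=> x y; rewrite /replace_edge.
  have -> : ([set x; y] == [set f u; f v]) = ([set g x; g y] == A).
    by rewrite EA !eq_set2 !(can2_eq gK fK).
  have := fm (g x) (g y); rewrite !gK /= => ->.
  rewrite /del_adj.
  case: eqP => [E|_]; last by rewrite andbT orbF.
  by rewrite orbT -edges_set2 E EA edges_set2.
by apply: contra (adj_neq uv) => /eqP/(can_inj fK)->.
Qed.

Definition switch (X : sgraph) (a b c : X) : rel X :=
  replace_edge [set a; b] [set a; c].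

(** The properties in the second line are those of G that are used, carried
    over to the vertices of H; this leaves H as the only graph in sight. *)
Definition good_switch (X : sgraph) (a b c : X) : Prop :=
  [/\ adj a b, adj b c & a != c] /\
  [/\ rel_triangle_free (switch a b c), dist_le2 (switch a b c)
    & cherries (switch a b c) = cherries (@adj X)].


(** The card without ab shows G as H - ab + C for some pair C, and C is not ab.
    In this graph a and b are nonadjacent, so they are joined through some z;
    since H has no triangle, C is one of az and zb, and the other one is an
    edge of H. *)
Lemma deck_good_switch (G H : sgraph) :
  4 <= #|edges G| -> triangle_free G -> dist_le2 (@adj G) ->
  same_edge_deck G H -> ~ iso H G ->
  forall a b : H, adj a b -> exists c, good_switch a b c \/ good_switch b a c.
Proof.
move=> m4 tG nG deck niso a b ab.
have tH := deck_triangle_free m4 tG deck.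
have chE := deck_cherries (ltnW m4) deck.
have [psi [_ psiE cards]] := deck.
have := ab; rewrite -edges_set2 -psiE => /imsetP[A AG EA].
have := cards _ AG; rewrite -EA => /(card_replace_edge AG) [g [p [q [gb gm pq]]]].
set C := [set p; q] in gm; set r := replace_edge _ C in gm.
have rch : cherries r = cherries (@adj H) by rewrite -chE (cherries_reindex gb gm).
have rt : rel_triangle_free r.
  move=> x y z; rewrite -!gm => xy yz xz.
  by have /negP[] := tG (g x) (g y) (g z); rewrite xy yz.
have rn : dist_le2 r.
  have [f gK fK] := gb; move=> x y xy; rewrite -gm => /nG[|z [xz zy]].
    by rewrite (can_eq gK).
  by exists (f z); rewrite -!gm fK.
have CA : C != [set a; b].
  apply: contra_notN niso => /eqP CE; exists g => // x y.
  rewrite gm /r /replace_edge CE /del_adj.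
  by case: eqP => [E|_]; rewrite ?andbT ?orbF // orbT -edges_set2 E edges_set2 ab.
have [|z] := rn a b (adj_neq ab).
  by rewrite /r /replace_edge /del_adj eqxx andbF eq_sym.
rewrite /r /replace_edge => -[].
case/orP => [/andP[az _]|/eqP azC].
  case/orP => [/andP[zb _]|/eqP zbC]; first by case: (tH a z b az zb ab).
  exists z; right; rewrite /good_switch /switch (setUC [set b] [set a]).
  rewrite (setUC [set b] [set z]) zbC; split=> //; split=> //; first by rewrite adj_sym.
  by apply: contraNneq pq => bz; move/eqP: zbC; rewrite -bz eq_set2 => /orP[] /andP[/eqP<- /eqP<-].
case/orP => [/andP[zb _]|/eqP zbC]; last first.
  move/eqP: zbC; rewrite -azC eq_set2 => /orP[] /andP[/eqP E1 /eqP E2].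
    by rewrite E2 E1 adj_irrefl in ab.
  by rewrite E2 adj_irrefl in ab.
exists z; left; rewrite /good_switch /switch azC; split=> //; split=> //.
  by rewrite adj_sym.
by apply: contraNneq pq => az; move/eqP: azC; rewrite -az eq_set2 => /orP[] /andP[/eqP<- /eqP<-].
Qed.


(** * Switches along unique paths of length 2 *)

Lemma switchC (X : sgraph) (a b c : X) : symmetric (switch a b c).
Proof.
by move=> x y; rewrite /switch /replace_edge del_adj_sym (setUC [set x]).
Qed.

Lemma switch_left (X : sgraph) (a b c x : X) :
  a != b -> a != c -> switch a b c a x = (adj a x && (x != b)) || (x == c).
Proof.
move=> ab ac; rewrite /switch /replace_edge /del_adj !eq_set2 eqxx.
by rewrite (negbTE ab) (negbTE ac) !orbF.
Qed.

Lemma switch_other (X : sgraph) (a b c x y : X) :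
  x != a -> y != a -> switch a b c x y = adj x y.
Proof.
move=> xa ya; rewrite /switch /replace_edge /del_adj !eq_set2.
by rewrite (negbTE xa) (negbTE ya) !andbF /= andbT orbF.
Qed.

(** Any other common neighbour of a and c would form a triangle with the new
    edge ac. *)
Lemma good_switch_mid (X : sgraph) (a b c x : X) :
  good_switch a b c -> adj a x -> adj c x -> x = b.
Proof.
move=> [[ab bc ac] [ts _ _]] ax cx; apply/eqP/negPn/negP => xb.
have an := adj_neq ab.
apply: (ts a x c); rewrite ?switch_left // ?ax ?xb // ?eqxx ?orbT //.
by rewrite switch_other // 1?adj_sym // eq_sym // adj_neq.
Qed.

(** After the switch a and z no longer have b in common. If z is not c, a new
    common neighbour can only come from the edge ac, so it is c; but then
    b, c, z is a triangle. *)
Lemma good_switch_unique (X : sgraph) (a b c z : X) :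
  rel_triangle_free (@adj X) -> good_switch a b c ->
  adj b z -> z != a -> (forall x, adj a x -> adj z x -> x = b) -> z = c.
Proof.
move=> tX [[ab bc ac] [_ ns _]] bz za zmid; apply/eqP/negPn/negP => zc.
have an := adj_neq ab.
have [||x [ax xz]] := ns a z; first by rewrite eq_sym.
  rewrite switch_left // (negbTE zc) orbF negb_and.
  by apply/orP; left; apply/negP; apply: tX ab bz.
have xa : x != a.
  by apply: contraTneq ax => ->; rewrite switch_left // adj_irrefl (negbTE ac).
move: ax xz; rewrite switch_left // switch_other //.
case/orP => [/andP[ax /negP xb] xz|/eqP-> cz]; last exact: tX bc cz bz.
by apply/xb/eqP/zmid; rewrite // adj_sym.
Qed.

(** After the switch b and z no longer have a in common, and the edge ac does
    not help as it ends at neither of them. So b and z have another common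
    neighbour: no unique path of length 2 through ab has its centre at a. *)
Lemma good_switch_detour (X : sgraph) (a b c z : X) :
  rel_triangle_free (@adj X) -> good_switch a b c -> adj a z -> z != b ->
  exists x, [/\ x != a, adj b x & adj z x].
Proof.
move=> tX [[ab bc ac] [_ ns _]] az zb.
have an := adj_neq ab; have zn := adj_neq az.
have [||x [bx xz]] := ns b z; first by rewrite eq_sym.
  rewrite switch_other 1?eq_sym //; apply/negP => bz; exact: tX ab bz az.
have xa : x != a.
  apply: contraTneq bx => ->; rewrite switchC switch_left // eqxx andbF /=.
  exact: adj_neq.
move: bx xz; rewrite eq_sym in an; rewrite eq_sym in zn.
rewrite !switch_other // => bx xz; by exists x; split; rewrite // adj_sym.
Qed.

(** The number of paths of length 2 is the sum of d (d - 1) over the vertex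
    degrees d. The switch lowers the degree of b by one and raises that of c by
    one, so keeping the sum forces 2 (deg b - 1) = 2 deg c. *)
Lemma good_switch_degree (X : sgraph) (a b c : X) :
  rel_triangle_free (@adj X) -> good_switch a b c ->
  degree (@adj X) b = (degree (@adj X) c).+1.
Proof.
move=> tX [[ab bc ac] [_ _]].
have an := adj_neq ab; have bn := adj_neq bc.
have nac : adj a c = false by apply/negP => /(tX _ _ _ ab bc).
set s := switch a b c.
have sL x : s a x = (adj a x && (x != b)) || (x == c) by exact: switch_left.
have sO x y : x != a -> y != a -> s x y = adj x y by exact: switch_other.
have sC : symmetric s by exact: switchC.
have db : degree (@adj X) b = (degree s b).+1.
  rewrite /degree (cardD1 a) inE adj_sym ab add1n; congr _.+1.
  apply: eq_card => x; rewrite !inE; have [->|xa] := eqVneq x a.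
    by rewrite sC sL eqxx (negbTE bn) andbF.
  by rewrite sO ?xa // eq_sym.
have dc : degree s c = (degree (@adj X) c).+1.
  rewrite /degree (cardD1 a) inE sC sL eqxx orbT add1n; congr _.+1.
  apply: eq_card => x; rewrite !inE; have [->|xa] := eqVneq x a.
    by rewrite adj_sym nac.
  by rewrite sO ?xa // eq_sym.
have dE y : y != b -> y != c -> degree s y = degree (@adj X) y.
  move=> yb yc; have [->|ya] := eqVneq y a.
    rewrite /degree (cardD1 c) [RHS](cardD1 b) !inE sL eqxx orbT ab; congr (_ + _).
    apply: eq_card => x; rewrite !inE sL andbC.
    by have [->|xc] := eqVneq x c; rewrite ?nac ?andbF ?orbF ?andbT // andbC.
  apply: eq_card => x; rewrite !inE; have [->|xa] := eqVneq x a; last exact: sO.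
  by rewrite sC sL yb (negbTE yc) orbF andbT adj_sym.
have cb : c != b by rewrite eq_sym.
rewrite !cherries_degree (bigD1 b) //= (bigD1 c) //= [RHS](bigD1 b) //= [in RHS](bigD1 c) //=.
rewrite (eq_bigr (fun y => degree (@adj X) y * (degree (@adj X) y).-1)); last first.
  by move=> y /andP[yb yc]; rewrite dE.
move/eqP; rewrite !addnA eqn_add2r db dc /=.
move: (degree s b) (degree _ c) => m n.
(* d (d - 1) increases by 2 k when d goes from k to k + 1 *)
have st k : k.+1 * k = k * k.-1 + k.*2.
  by case: k => // k; rewrite mulnC -muln2 -mulnDr addn2.
by rewrite !st -addnA eqn_add2l addnC eqn_add2r => /eqP/double_inj->.
Qed.

(** The switch of the edge bc cannot go along a path centred at c, because of
    [good_switch_detour]; so it goes along c - b - a by uniqueness, and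
    [good_switch_degree] applies to that path. *)
Lemma good_switch_far_degree (X : sgraph) (a b c : X) :
  rel_triangle_free (@adj X) ->
  (forall x y : X, adj x y -> exists z, good_switch x y z \/ good_switch y x z) ->
  good_switch a b c -> degree (@adj X) b = (degree (@adj X) a).+1.
Proof.
move=> tX sw gs; have [[ab bc ac] _] := gs.
have ba : adj b a by rewrite adj_sym.
have [d [gs'|gs']] := sw b c bc.
  have [x [xb cx ax]] := good_switch_detour tX gs' ba ac.
  by rewrite (good_switch_mid gs ax cx) eqxx in xb.
rewrite (good_switch_degree tX gs') (good_switch_unique tX gs' ba ac) // => x cx ax.
exact: good_switch_mid gs ax cx.
Qed.

(** * Degree parity and the conclusion *)

(** Adjacent vertices have degrees of opposite parity. Let X and Y be the parity
    classes of a and b. Two vertices in different classes that are joined after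
    the switch a - b - c without being adjacent need the edge ac, the only edge
    within a class. Hence every vertex of X other than a and c sees all of Y,
    while each vertex of Y sees at least one of a and c, and only b sees both. A
    vertex of Y other than b would have degree |X| - 1, whereas b has degree
    |X|: this is absurd as both degrees have the same parity. So Y = {b}, and
    the degrees 1 of a and 2 of b leave no room for a third edge. *)
Lemma not_all_switchable (X : sgraph) :
  2 < #|edges X| -> rel_triangle_free (@adj X) ->
  ~ (forall x y : X, adj x y -> exists z, good_switch x y z \/ good_switch y x z).
Proof.
move=> m3 tX sw; set d := degree (@adj X).
have odd_adj x y : adj x y -> odd (d x) = ~~ odd (d y).
  move=> /sw[z []] gs; have := good_switch_far_degree tX sw gs;
    by rewrite -/d => -> /=; rewrite ?negbK.
have [a [b [c gs]]] : exists a b c : X, good_switch a b c.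
  have /card_gt0P[A /edgesP[x [y [xy _]]]] : 0 < #|edges X| by exact: leq_trans m3.
  by have [z [gs|gs]] := sw x y xy; [exists x, y, z|exists y, x, z].
have [[ab bc ac] [_ ns _]] := gs; have an := adj_neq ab.
have db : d b = (d a).+1 := good_switch_far_degree tX sw gs.
have ob : odd (d b) = ~~ odd (d a) by rewrite db.
have dbc : d b = (d c).+1 := good_switch_degree tX gs.
have mid x : adj a x -> adj c x -> x = b by exact: good_switch_mid gs.
have dca : d c = d a by apply: succn_inj; rewrite -dbc.
have full x y : odd (d x) = odd (d a) -> odd (d y) = ~~ odd (d a) ->
    x != a -> x != c -> adj x y.
  move=> ox oy xa xc; apply/negPn/negP => nxy.
  have ya : y != a by apply: contra_eq_neq oy => ->; case: odd.
  have xy : x != y by apply: contra_eq_neq oy => <-; rewrite ox; case: odd.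
  have [|t [xt ty]] := ns x y xy; first by rewrite switch_other.
  have ta : t != a.
    apply: contraTneq xt => ->; rewrite switchC switch_left // (negbTE xc) orbF.
    by apply/negP => /andP[/odd_adj]; rewrite ox; case: odd.
  move: xt ty; rewrite !switch_other // => /odd_adj + /odd_adj.
  by rewrite ox oy => ->; case: odd.
have cover y : odd (d y) = ~~ odd (d a) -> adj a y || adj c y.
  move=> oy; apply/negPn; rewrite negb_or; apply/negP => /andP[nay ncy].
  have ya : y != a by apply: contra_eq_neq oy => ->; case: odd.
  have yc : y != c by apply: contra_eq_neq oy => ->; rewrite dca; case: odd.
  have [||t [at_ ty]] := ns a y; first by rewrite eq_sym.
    by rewrite switch_left // (negbTE nay) (negbTE yc).
  have ta : t != a.
    by apply: contraTneq at_ => ->; rewrite switch_left // adj_irrefl (negbTE ac).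
  move: at_ ty; rewrite switch_left // switch_other //.
  case/orP => [/andP[/odd_adj + _] /odd_adj|/eqP->]; last by rewrite (negbTE ncy).
  by rewrite oy => ->; case: odd.
(* a vertex y of the class of b cannot miss exactly one of a and c: its
   neighbourhood would be that of b minus one vertex *)
have miss y w : odd (d y) = ~~ odd (d a) -> y != b -> w \in [set a; c] ->
    ~~ adj w y -> (forall v, v \in [set a; c] -> v != w -> adj v y) -> False.
  move=> oy yb wac nwy vwy.
  have bw : adj b w by case/set2P: wac => -> //; rewrite adj_sym.
  have ow : odd (d w) = odd (d a) by case/set2P: wac => ->; rewrite ?dca.
  have : d b = (d y).+1.
    rewrite /d /degree (cardD1 w) inE bw add1n; congr _.+1; apply: eq_card => x.
    rewrite !inE; have [->|xw] /= := eqVneq x w.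
      by rewrite adj_sym (negbTE nwy).
    have [ox|/eqP ox] := eqVneq (odd (d x)) (odd (d a)).
      have [xac|] := boolP (x \in [set a; c]).
        rewrite (adj_sym y) vwy //; case/set2P: xac => -> //.
        by rewrite adj_sym.
      rewrite !inE negb_or => /andP[xa xc].
      by rewrite adj_sym full ?ob // [RHS]adj_sym full.
    by apply/idP/idP => /odd_adj; rewrite ?ob ?oy => /negb_inj/esym/ox.
  by move/(congr1 odd); rewrite db /= oy; case: odd.
have Yb y : odd (d y) = ~~ odd (d a) -> y = b.
  move=> oy; apply/eqP/negPn/negP => yb.
  have [ay|ay] := boolP (adj a y); last first.
    apply: (miss y a) => //; first exact: set21.
    by move=> v /set2P[->|->]; rewrite ?eqxx //; have := cover y oy; rewrite (negbTE ay).
  apply: (miss y c) => //; first exact: set22.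
    by apply: contra yb => /(mid _ ay)/eqP.
  by move=> v /set2P[->|->]; rewrite ?eqxx.
have da : d a = 1.
  rewrite /d /degree -(card1 b); apply: eq_card => x; rewrite !inE.
  apply/idP/eqP => [/odd_adj ox|-> //]; apply: Yb; by rewrite ox negbK.
have : edges X \subset [set [set b; x] | x in [pred x | adj b x]].
  apply/subsetP => _ /edgesP[x [y [xy ->]]]; apply/imsetP.
  have [ox|/eqP ox] := eqVneq (odd (d x)) (odd (d a)).
    have yb : y = b by apply: Yb; rewrite -ox (odd_adj _ _ xy) negbK.
    by exists x; rewrite ?inE -yb 1?adj_sym // setUC.
  have xb : x = b by apply: Yb; case: odd ox => //; case: odd.
  by exists y; rewrite ?inE -xb.
move/subset_leq_card/leq_trans => /(_ _ (leq_imset_card _ _)).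
by rewrite -/(degree _ b) -/d db da leqNgt m3.
Qed.

Lemma iso_or_not (G H : sgraph) : iso G H \/ ~ iso G H.
Proof.
pose b := [exists f : {ffun G -> H}, [&& injectiveb f, #|H| <= #|G|
  & [forall x, forall y, adj (f x) (f y) == adj x y]]].
have bP : reflect (iso G H) b.
  apply: (iffP existsP) => [[f /and3P[/injectiveP fi le fm]]|[f fb fm]].
    exists f; first exact: inj_card_bij fi le.
    by move=> x y; apply/eqP; move/forallP/(_ x)/forallP/(_ y): fm.
  exists [ffun x => f x]; apply/and3P; split.
  - by apply/injectiveP => x y; rewrite !ffunE; apply: bij_inj.
  - by rewrite (bij_eq_card fb).
  - by apply/forallP => x; apply/forallP => y; rewrite !ffunE fm.
by case: bP; [left|right].
Qed.

Theorem theorem1p7 (G : sgraph)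
    (G_triangle_free : triangle_free G)
    (G_diam : diam G = Some 2)
    (G_edges : 4 <= #|edges G|) :
  edge_reconstructible G.
Proof.
move=> H deck; have [//|niso] := iso_or_not H G.
have G_dist_le2 := diam2_dist_le2 G_edges G_diam.
have := deck_good_switch G_edges G_triangle_free G_dist_le2 deck niso.
case/not_all_switchable; last exact: deck_triangle_free deck.
have [psi [psi_inj <- _]] := deck.
by rewrite card_in_imset // (leq_trans _ G_edges).
Qed.
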